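(* Let $d\ge 1$ and consider a non-backtracking random walk on the infinite grid $\mathbb{Z}^d$ (the graph with vertex set $\mathbb{Z}^d$ in which two vertices are adjacent iff they differ by $\pm1$ in exactly one coordinate). This walk is recurrent if $d=2$ and transient if $d=1$ or $d\ge 3$.
   Context: A non-backtracking random walk on a graph $G$ started at $v_0$ is a random sequence of vertices $(v_0,v_1,v_2,\dots)$ where $v_1$ is chosen uniformly at random among the neighbors of $v_0$, and for $i\ge1$, $v_{i+1}$ is chosen uniformly at random among the neighbors of $v_i$ different from $v_{i-1}$. The walk is called recurrent if with probability $1$ there is some $k\ge1$ with $v_k=v_0$, and transient if this probability is less than $1$. *)

(* Defs.v *)
From HB Require Import structures.
From mathcomp Require Export all_boot all_order all_algebra finmap.
From mathcomp Require Export all_classical all_reals all_analysis.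

Set Implicit Arguments.
Unset Strict Implicit.
Unset Printing Implicit Defensive.

Import Order.TTheory GRing.Theory Num.Theory.

Local Open Scope classical_set_scope.
Local Open Scope ring_scope.

(* A graph on a vertex type [V] is given by its adjacency relation
   [adj : V -> V -> Prop]. *)

Definition grid_adj (d : nat) (x y : 'rV[int]_d) : Prop :=
  exists i : 'I_d, `|x 0 i - y 0 i| = 1 /\
    forall j : 'I_d, j != i -> x 0 j = y 0 j.

Section Walk.
Context {V : choiceType} (adj : V -> V -> Prop).

(* The uniform law on a finite nonempty set [A].  For [A] empty or infinite
   this is the zero function, hence not a probability mass function. *)
Definition uniform_pmf (R : realType) (A : set V) (y : V) : R :=
  \1_A y / #|` fset_set A|%:R.

(* The vertices allowed at time [n.+1] after the history [x 0, ..., x n]. *)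
Definition nb_choices (x : nat -> V) (n : nat) : set V :=
  match n with
  | 0%N => [set y | adj (x 0%N) y]
  | m.+1 => [set y | adj (x m.+1) y /\ y <> x m]
  end.

Context {R : realType} {disp : measure_display} {T : measurableType disp}
  (P : probability T R).

Definition cylinder (X : nat -> T -> V) (x : nat -> V) (n : nat) : set T :=
  [set w | forall i : nat, (i <= n)%N -> X i w = x i].

(* Each [X n] is measurable for the discrete sigma-algebra on [V].  The law of
   the next vertex conditionally on the whole past is stated in product form,
   which also makes sense for histories of probability zero. *)
Record non_backtracking_walk (v0 : V) (X : nat -> T -> V) : Prop := {
  nbw_measurable : forall (n : nat) (A : set V), measurable (X n @^-1` A) ;
  nbw_start : P [set w | X 0%N w = v0] = 1%E ;
  nbw_step : forall (x : nat -> V) (n : nat),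
    P (cylinder X x n.+1) =
      (P (cylinder X x n) * (uniform_pmf R (nb_choices x n) (x n.+1))%:E)%E
}.

Definition return_event (X : nat -> T -> V) : set T :=
  [set w | exists k : nat, (1 <= k)%N /\ X k w = X 0%N w].

Definition recurrent (X : nat -> T -> V) : Prop := P (return_event X) = 1%E.

Definition transient (X : nat -> T -> V) : Prop := (P (return_event X) < 1)%E.

End Walk.

(* Main.v *)
(* A lattice symmetry carries any last direction to any other, so arriving at a
   site is a renewal time. Decomposing at the last visit to [x] gives
   [sum_(k <= n) P(X_k = x) P(no return within n - k steps) <= 1], with equality
   for [x = 0]; hence the walk is transient iff the expected number of visits
   to 0 is finite.

   For any [g], non-backtracking turns the law of the next step into
   [(2d - 1) E g(X_(n+2)) + E g(X_n) = E (L g)(X_(n+1))], where [L g] sums [g]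
   over neighbors. Summing over [n] telescopes, so the total mass that the walk
   gives to [2d g - L g], the Laplacian of simple random walk, is a boundary
   term. Taking [g = - |x|] for [d = 1] and [g = (|x|^2 + 10)^(-1/2)] for
   [d >= 3] bounds the number of visits to 0. For [d = 2],
   [g = max (0, M - ln (2 |x|^2 - 1))] is subharmonic off 0 and finitely
   supported; if the walk were transient, [E g(X_n)] would get small, and the
   identity would make the number of visits to 0 grow linearly in [M]. *)
Require Import Defs.
From mathcomp Require Import perm zify ring lra.
Set Implicit Arguments.
Unset Strict Implicit.
Unset Printing Implicit Defensive.

Import Order.TTheory GRing.Theory Num.Theory.

Local Open Scope classical_set_scope.
Local Open Scope ring_scope.

(** * Directions and steps on the lattice *)

Section Lattice.
Context {d : nat}.

Definition direction : finType := ('I_d * bool)%type.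

Definition step (h : direction) : 'rV[int]_d := (-1) ^+ h.2 *: delta_mx 0 h.1.

Definition reverse (h : direction) : direction := (h.1, ~~ h.2).

Lemma reverseK : involutive reverse.
Proof. by case=> i b; rewrite /reverse /= negbK. Qed.

Lemma step_reverse h : step (reverse h) = - step h.
Proof.
rewrite /step /=; case: h.2;
  by rewrite /= ?expr0 ?expr1 scale1r scaleN1r ?opprK.
Qed.

Lemma stepE h j : step h 0 j = if j == h.1 then (-1) ^+ h.2 else 0.
Proof. by rewrite !mxE eqxx /=; case: eqP; rewrite ?mulr1 ?mulr0. Qed.

Lemma add_stepE (x : 'rV[int]_d) h j :
  (x + step h) 0 j = x 0 j + (if j == h.1 then (-1) ^+ h.2 else 0).
Proof. by rewrite mxE stepE. Qed.

Lemma step_inj : injective step.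
Proof.
move=> [i b] [j c] /rowP /(_ i); rewrite !stepE eqxx /=.
by case: eqP => [->|_]; case: b; case: c.
Qed.

Lemma step_neq0 h : step h != 0.
Proof.
apply/eqP => /rowP /(_ h.1); rewrite stepE mxE eqxx.
by case: h.2.
Qed.

Lemma grid_adjP (x y : 'rV[int]_d) :
  grid_adj x y <-> exists h, y = x + step h.
Proof.
split=> [[i [xyi xyj]]|[h ->]].
- have [xy|xy] : y 0 i = x 0 i + 1 \/ y 0 i = x 0 i - 1 by lia.
  + exists (i, false); apply/rowP => j; rewrite mxE stepE /=.
    by case: eqP => [->//|/eqP/xyj ->]; rewrite addr0.
  + exists (i, true); apply/rowP => j; rewrite mxE stepE /=.
    by case: eqP => [->//|/eqP/xyj ->]; rewrite addr0.
- exists h.1; split=> [|j /negPf jh].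
    by rewrite mxE stepE eqxx opprD addNKr normrN normrX normrN1 expr1n.
  by rewrite mxE stepE jh addr0.
Qed.

(* [o] is the direction of the last step, [None] at the start of the walk. *)
Definition allowed (o : option direction) : pred direction :=
  [pred h | o != Some (reverse h)].

Lemma card_direction : #|direction| = (2 * d)%N.
Proof. by rewrite card_prod card_ord card_bool mulnC. Qed.

Lemma card_allowed_None : #|allowed None| = (2 * d)%N.
Proof.
rewrite -card_direction.
by apply: (@eq_card direction) => h; rewrite inE.
Qed.

Lemma allowed_Some h k : allowed (Some h) k = (k != reverse h).
Proof. by rewrite /=; congr (~~ _); apply/eqP/eqP => [[->]|->]; rewrite reverseK. Qed.

Lemma card_allowed_Some h : #|allowed (Some h)| = (2 * d).-1.
Proof.
rewrite -card_direction -(cardC1 (reverse h)); apply: (@eq_card direction) => k.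
by rewrite !inE -allowed_Some.
Qed.

End Lattice.
Arguments direction : clear implicits.

(** * The walk as a Markov chain on pairs of a site and a last direction *)

Section Walk.
Context {R : realType} {d : nat} (d_gt0 : (0 < d)%N).
Implicit Types (o : option (direction d)) (e : direction d) (g : 'rV[int]_d -> R)
  (x y z : 'rV[int]_d) (h : direction d).

Definition mean o (F : direction d -> R) : R :=
  (\sum_(h | allowed o h) F h) / #|allowed o|%:R.

Fixpoint expect (n : nat) g y o : R :=
  if n is m.+1 then mean o (fun h => expect m g (y + step h) (Some h))
  else g y.

(** Only the [n] sites after [z] are tested, not [z] itself, so [avoid n 0 o] is the probability of
    no return to 0 within [n] steps. *)
Fixpoint avoid (n : nat) z o : R :=
  if n is m.+1 then
    mean o (fun h => (z + step h != 0)%:R * avoid m (z + step h) (Some h))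
  else 1.

Definition neighbor_sum g y : R := \sum_h g (y + step h).

Lemma card_allowed_gt0 o : (0 < #|allowed o|)%N.
Proof. by case: o => [h|]; rewrite ?card_allowed_Some ?card_allowed_None; lia. Qed.

Lemma card_allowed_neq0 o : #|allowed o|%:R != 0 :> R.
Proof. by rewrite pnatr_eq0 -lt0n card_allowed_gt0. Qed.

Lemma eq_mean o F G : F =1 G -> mean o F = mean o G.
Proof. by move=> FG; rewrite /mean; under eq_bigr do rewrite FG. Qed.

Lemma meanD o F G : mean o (fun h => F h + G h) = mean o F + mean o G.
Proof. by rewrite /mean big_split mulrDl. Qed.

Lemma meanZ o a F : mean o (fun h => a * F h) = a * mean o F.
Proof. by rewrite /mean -mulr_sumr mulrA. Qed.

Lemma mean_const o a : mean o (fun=> a) = a.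
Proof.
by rewrite /mean sumr_const -(mulr_natr a) mulfK // card_allowed_neq0.
Qed.

Lemma mean_le o F G : (forall h, F h <= G h) -> mean o F <= mean o G.
Proof. by move=> FG; rewrite /mean ler_wpM2r ?invr_ge0 ?ler_sum. Qed.

Lemma mean_sum o (I : Type) (r : seq I) (F : I -> direction d -> R) :
  mean o (fun h => \sum_(i <- r) F i h) = \sum_(i <- r) mean o (F i).
Proof. by rewrite /mean exchange_big mulr_suml. Qed.

Lemma eq_mean_const o F a :
  (forall h, F h = a) -> mean o F = a.
Proof. by move=> Fa; rewrite (eq_mean o Fa) mean_const. Qed.

Lemma eq_expect n g1 g2 y o : g1 =1 g2 -> expect n g1 y o = expect n g2 y o.
Proof.
move=> g12; elim: n y o => [|n IHn] y o /=; first exact: g12.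
by apply: eq_mean => h; apply: IHn.
Qed.

Lemma expectD n g1 g2 y o :
  expect n (fun x => g1 x + g2 x) y o = expect n g1 y o + expect n g2 y o.
Proof.
elim: n y o => //= n IHn y o; rewrite -meanD.
by apply: eq_mean => h; apply: IHn.
Qed.

Lemma expectZ n a g y o :
  expect n (fun x => a * g x) y o = a * expect n g y o.
Proof.
elim: n y o => //= n IHn y o; rewrite -meanZ.
by apply: eq_mean => h; apply: IHn.
Qed.

Lemma expect_const n a y o : expect n (fun=> a) y o = a.
Proof.
by elim: n y o => //= n IHn y o; apply: eq_mean_const => h; apply: IHn.
Qed.

Lemma expect_le n g1 g2 y o :
  (forall x, g1 x <= g2 x) -> expect n g1 y o <= expect n g2 y o.
Proof.
move=> g12; elim: n y o => [|n IHn] y o //=.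
by apply: mean_le => h; apply: IHn.
Qed.

Lemma expect_sum n (I : Type) (r : seq I) (G : I -> 'rV[int]_d -> R) y o :
  expect n (fun x => \sum_(i <- r) G i x) y o =
  \sum_(i <- r) expect n (G i) y o.
Proof.
elim: n y o => //= n IHn y o; rewrite -mean_sum.
by apply: eq_mean => h; apply: IHn.
Qed.

Lemma expectS n g y o :
  expect n.+1 g y o = mean o (fun h => expect n g (y + step h) (Some h)).
Proof. by []. Qed.

(** After a step [h] the walk may take every direction except [reverse h], which would lead back to
    [y]; adding [g y] completes the sum over all neighbors of [y + step h]. *)
Lemma expectSS n g y o :
  (2 * d).-1%:R * expect n.+2 g y o + expect n g y o =
  expect n.+1 (neighbor_sum g) y o.
Proof.
elim: n y o => [|n IHn] y o.
  rewrite /= -meanZ -[X in _ + X](mean_const o) -meanD.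
  apply: eq_mean => h.
  rewrite /mean card_allowed_Some mulrC divfK; last first.
    by rewrite -(card_allowed_Some h) card_allowed_neq0.
  rewrite /neighbor_sum [RHS](bigD1 (reverse h)) //= step_reverse addrK addrC.
  by congr (_ + _); apply: eq_bigl => k; rewrite allowed_Some.
rewrite expectS [X in _ + X = _]expectS [RHS]expectS -meanZ -meanD.
by apply: eq_mean => h; rewrite -IHn.
Qed.

(** By [expectSS] each term equals [(2d - 1) (E_n - E_(n+1)) + (E_n - E_(n-1))], where [E_n] is the
    expectation of [g] after [n] steps. *)
Lemma expect_telescope N g y o :
  \sum_(1 <= n < N.+1)
     expect n (fun x => (2 * d)%:R * g x - neighbor_sum g x) y o =
  (2 * d).-1%:R * expect 1 g y o - expect 0 g y o
  + expect N g y o - (2 * d).-1%:R * expect N.+1 g y o.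
Proof.
elim: N => [|N IHN]; first by rewrite big_geq //; ring.
rewrite big_nat_recr //= -/(expect N.+1 _ y o) IHN.
have -> : expect N.+1 (fun x => (2 * d)%:R * g x - neighbor_sum g x) y o =
   (2 * d)%:R * expect N.+1 g y o - expect N.+1 (neighbor_sum g) y o.
  rewrite -expectZ -[in RHS]mulN1r -expectZ -expectD.
  by apply: eq_expect => x; rewrite mulN1r.
rewrite -expectSS.
have -> : (2 * d)%:R = (2 * d).-1%:R + 1 :> R by rewrite natr1; congr _%:R; lia.
rewrite -/(expect N.+2 g y o) -/(expect N.+1 g y o) /=; ring.
Qed.

Lemma expect_ge0 n g y o : (forall x, 0 <= g x) -> 0 <= expect n g y o.
Proof. by move=> /(@expect_le n (fun=> 0) g y o); rewrite expect_const. Qed.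

Lemma avoidS n z o : avoid n.+1 z o =
  mean o (fun h => (z + step h != 0)%:R * avoid n (z + step h) (Some h)).
Proof. by []. Qed.

Lemma avoid_ge0 n z o : 0 <= avoid n z o.
Proof.
elim: n z o => //= n IHn z o; rewrite -[leLHS](mean_const o).
by apply: mean_le => h; rewrite mulr_ge0.
Qed.

Lemma avoid_le1 n z o : avoid n z o <= 1.
Proof.
elim: n z o => //= n IHn z o; rewrite -[leRHS](mean_const o).
apply: mean_le => h; case: (_ != _); last by rewrite mul0r ler01.
by rewrite mul1r.
Qed.

Lemma avoid_succ_le n z o : avoid n.+1 z o <= avoid n z o.
Proof.
elim: n z o => [|n IHn] z o; first exact: avoid_le1.
by rewrite avoidS [leRHS]avoidS; apply: mean_le => h; apply: ler_wpM2l.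
Qed.

Lemma avoid_le m n z o : (m <= n)%N -> avoid n z o <= avoid m z o.
Proof.
move=> /subnK <-; elim: (n - m)%N => //= k IHk.
exact: le_trans (avoid_succ_le _ _ _) IHk.
Qed.

Lemma avoid_symm (s : 'rV[int]_d -> 'rV[int]_d)
    (t : direction d -> direction d) n z o :
  s 0 = 0 -> injective s -> injective t ->
  (forall y h, s (y + step h) = s y + step (t h)) ->
  (forall h, t (reverse h) = reverse (t h)) ->
  avoid n (s z) (omap t o) = avoid n z o.
Proof.
move=> s0 s_inj t_inj s_step t_rev; elim: n z o => //= n IHn z o.
have tb : bijective t by apply: injF_bij.
have tallowed h : allowed (omap t o) (t h) = allowed o h.
  case: o => [k|] //.
  by rewrite [omap _ _]/= !allowed_Some -t_rev (inj_eq t_inj).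
rewrite /mean; congr (_ / _).
  rewrite (reindex t) /=; last by case: tb => u tu ut; exists u.
  apply: eq_big => h; first exact: tallowed.
  move=> _; rewrite -s_step -[in _ != _]s0 (inj_eq s_inj).
  by rewrite -(IHn (z + step h)).
by case: (o) => [k|] //=; rewrite !card_allowed_Some.
Qed.

Lemma avoid_step n h k :
  avoid n (step h) (Some h) = avoid n (step k) (Some k).
Proof.
(* Swap the axes of [h] and [k], and apply the central reflection if their signs differ; this
   carries [h] to [k]. *)
pose p := tperm h.1 k.1; pose b := h.2 (+) k.2.
pose s (x : 'rV[int]_d) : 'rV[int]_d := (-1) ^+ b *: col_perm p x.
pose t (x : direction d) : direction d := (p x.1, x.2 (+) b).
have st e : step (t e) = s (step e).
  apply/rowP => j; rewrite [LHS]stepE [RHS]mxE [X in _ * X]mxE stepE /=.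
  rewrite -[in j == _](tpermK h.1 k.1 j) (inj_eq perm_inj).
  by case: eqP => _; rewrite ?mulr0 // mulrC signr_addb.
have th : t h = k.
  by rewrite /t /p tpermL /b addbA addbb; case: (k).
rewrite -th st -[Some (t h)]/(omap t (Some h)) avoid_symm //.
- by apply/rowP => j; rewrite !mxE mulr0.
- move=> x y xy; apply/rowP => j; have := congr1 (fun u : 'rV[int]_d => u 0 (p j)) xy.
  rewrite !mxE /p tpermK => /(congr1 (fun u => (-1) ^+ b * u)).
  by rewrite !mulrA -signr_addb addbb !mul1r.
- move=> [i c] [j c'] [/perm_inj -> /(congr1 (addb^~ b))].
  by rewrite !addbK => ->.
- move=> y e; rewrite st /s -scalerDr; congr (_ *: _).
  by apply/rowP => j; rewrite !mxE.
- by move=> e; rewrite /t /reverse /= addNb.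
Qed.

(** By [avoid_step] every first step leads to the same value, so the mean does not depend on which
    steps are allowed. *)
Lemma avoid_origin n o o' : avoid n 0 o = avoid n 0 o'.
Proof.
pose h0 : direction d := (Ordinal d_gt0, false).
suff av o1 : avoid n 0 o1 = if n is m.+1 then avoid m (step h0) (Some h0) else 1.
  by rewrite !av.
case: n => //= n; apply: eq_mean_const => h.
by rewrite add0r step_neq0 mul1r; apply: avoid_step.
Qed.

(* The probability that the last visit to [x] within [n] steps takes place at
   time [k] is [expect k (x == _) y o * avoid (n - k) 0 None]; it does not
   depend on the direction of arrival at [x], by symmetry. *)
Lemma last_exit n x y o :
  \sum_(k < n.+1) expect k (fun v => (v == x)%:R) y o * avoid (n - k) 0 None
  + (y != x)%:R * avoid n (y - x) o = 1.
Proof.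
elim: n y o => [|n IHn] y o.
  by rewrite big_ord_recl big_ord0 /= !mulr1 addr0; case: eqP; rewrite ?addr0 ?add0r.
rewrite big_ord_recl subn0 /=.
have -> : \sum_(i < n.+1) expect (bump 0 i) (fun v => (v == x)%:R) y o *
            avoid (n.+1 - bump 0 i) 0 None =
          mean o (fun h => \sum_(i < n.+1)
            expect i (fun v => (v == x)%:R) (y + step h) (Some h) *
            avoid (n - i) 0 None).
  rewrite mean_sum; apply: eq_bigr => i _.
  rewrite /bump /= add1n subSS /= mulrC -meanZ.
  by apply: eq_mean => h; rewrite mulrC.
have -> : mean o (fun h => \sum_(i < n.+1)
            expect i (fun v => (v == x)%:R) (y + step h) (Some h) *
            avoid (n - i) 0 None) = 1 - avoid n.+1 (y - x) o.
  apply/eqP; rewrite eq_sym subr_eq -meanD eq_sym; apply/eqP.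
  apply: eq_mean_const => h; rewrite -[RHS](IHn (y + step h) (Some h)).
  by congr (_ + _); rewrite addrAC subr_eq0.
(* For [y = x] the time-0 term carries [None] while the recursion produced [o]; [avoid_origin]
   identifies the two. *)
have [->|yx] := eqVneq y x.
  rewrite subrr (avoid_origin _ o None) /=; ring.
rewrite /=; ring.
Qed.

End Walk.

(** * Expected visits, and a superharmonic criterion for transience *)

Section Visits.
Context {R : realType} {d : nat} (d_gt0 : (0 < d)%N).
Implicit Types (o : option (direction d)) (g : 'rV[int]_d -> R)
  (x y z : 'rV[int]_d) (h : direction d).

Definition visit n x y o : R := expect n (fun v => (v == x)%:R) y o.

Lemma visit_ge0 n x y o : 0 <= visit n x y o.
Proof. by apply: expect_ge0 => // v; apply: ler0n. Qed.

(** In [last_exit] every factor [avoid] is at least [t], while the sum is at most 1. *)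
Lemma sum_visit_le (t : R) n x y o :
  0 < t -> (forall m, t <= avoid m 0 (@None (direction d))) ->
  \sum_(k < n) visit k x y o <= t^-1.
Proof.
move=> t0 tav; rewrite -[leRHS]mul1r ler_pdivlMr //.
rewrite -[leRHS](last_exit d_gt0 n x y o) big_ord_recr /= mulr_suml.
rewrite -addrA; apply: ler_wpDr.
  by rewrite addr_ge0 // mulr_ge0 ?visit_ge0 ?avoid_ge0.
by apply: ler_sum => k _; rewrite ler_wpM2l ?visit_ge0.
Qed.

Lemma avoid_lower_bound (K : R) :
  (forall n, \sum_(k < n) visit k 0 0 (@None (direction d)) <= K) ->
  exists2 e : R, 0 < e & forall m, e <= avoid m 0 (@None (direction d)).
Proof.
pose u k : R := visit k 0 0 (@None (direction d)).
pose tau m : R := avoid m 0 (@None (direction d)).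
move=> uK; have {}uK n : \sum_(k < n) u k <= K := uK n.
have u0 k : 0 <= u k by apply: visit_ge0.
have K1 : 1 <= K.
  by apply: le_trans (uK 1%N); rewrite big_ord1 /u /visit /= eqxx.
exists (2 * K)^-1 => [|m]; first by rewrite invr_gt0; lra.
rewrite leNgt; apply/negP => tauK.
(* In [last_exit] at horizon [p + m], the times [k < p] leave more than [m] steps, so they
   contribute at most [K / (2K) = 1/2]. Each window of [m + 1] times thus holds at least half an
   expected visit, against the bound [K]. *)
have block p : 1 / 2 <= \sum_(p <= k < p + m.+1) u k.
  have := last_exit (R := R) d_gt0 (p + m) 0 0 None.
  rewrite eqxx mul0r addr0 -(big_mkord xpredT (fun k => u k * tau (p + m - k)%N)).
  rewrite (@big_cat_nat _ _ _ p) //=; last by lia.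
  have le1 : \sum_(0 <= k < p) u k * tau (p + m - k)%N <= K * (2 * K)^-1.
    apply: (@le_trans _ _ (\sum_(0 <= k < p) u k * (2 * K)^-1)).
      apply: ler_sum_nat => k /andP[_ kp]; apply: ler_wpM2l => //.
      by apply: le_trans (ltW tauK); apply: avoid_le => //; lia.
    rewrite -mulr_suml ler_wpM2r ?invr_ge0 ?big_mkord; [|lra|exact: uK].
    by [].
  have le2 : \sum_(p <= k < (p + m).+1) u k * tau (p + m - k)%N <=
             \sum_(p <= k < (p + m).+1) u k.
    by apply: ler_sum => k _; rewrite ler_piMr // avoid_le1.
  have KK : K * (2 * K)^-1 = 1 / 2 by field; lra.
  rewrite KK in le1; rewrite addnS => sum1.
  have := lerD le1 le2; rewrite sum1; lra.
have blocks j : j%:R / 2 <= \sum_(0 <= k < j * m.+1) u k.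
  elim: j => [|j IHj]; first by rewrite mul0r big_geq.
  rewrite mulSn addnC (@big_cat_nat _ _ _ (j * m.+1)) //=; last by lia.
  by rewrite -natr1 mulrDl; apply: lerD (block _).
have [j jK] : exists j : nat, 2 * K < j%:R.
  by exists (Num.bound (2 * K)); apply: le_lt_trans (archi_boundP _); lra.
have := blocks j; rewrite big_mkord; have := uK (j * m.+1)%N; lra.
Qed.

Lemma avoid_lower_bound_superharmonic g (c K : R) :
  0 < c -> (forall x, c * (x == 0)%:R <= (2 * d)%:R * g x - neighbor_sum g x) ->
  (forall N, (2 * d).-1%:R * expect 1 g 0 None - g 0
     + expect N g 0 None - (2 * d).-1%:R * expect N.+1 g 0 None <= K) ->
  exists2 e : R, 0 < e & forall m, e <= avoid m 0 (@None (direction d)).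
Proof.
(* The 1 counts the visit at time 0, which the telescoped sum, starting at time 1, leaves out. *)
move=> c0 gc gK; apply: (@avoid_lower_bound (1 + K / c)) => -[|N].
  rewrite big_ord0 addr_ge0 // divr_ge0 ?(ltW c0) //.
  apply: le_trans (gK 0%N).
  by rewrite -[g 0]/(expect 0 g 0 None) -expect_telescope // big_geq.
rewrite big_ord_recl; apply: lerD; first by rewrite /visit /= eqxx.
rewrite ler_pdivlMr //; apply: le_trans (gK N).
rewrite -expect_telescope // big_add1 big_mkord mulr_suml.
apply: ler_sum => k _; rewrite mulrC -expectZ.
by apply: expect_le.
Qed.

End Visits.

(** * The squared Euclidean norm *)

Section SquaredNorm.
Context {d : nat}.
Implicit Types (x : 'rV[int]_d).

Definition normsq x : int := \sum_i x 0 i ^+ 2.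

Lemma normsq_ge0 x : 0 <= normsq x.
Proof. by apply: sumr_ge0 => i _; apply: sqr_ge0. Qed.

Lemma sqr_coord_le x i : x 0 i ^+ 2 <= normsq x.
Proof.
rewrite /normsq (bigD1 i) //= ler_wpDr // sumr_ge0 // => j _.
exact: sqr_ge0.
Qed.

Lemma normsq0 : normsq 0 = 0.
Proof. by rewrite /normsq big1 // => i _; rewrite mxE expr0n. Qed.

Lemma normsq_eq0 x : (normsq x == 0) = (x == 0).
Proof.
apply/eqP/eqP => [x0|->]; last exact: normsq0.
apply/rowP => i; rewrite mxE.
by apply/eqP; rewrite -sqrf_eq0 eq_le sqr_ge0 andbT -x0 sqr_coord_le.
Qed.

Lemma normsq_step x h :
  normsq (x + step h) = normsq x + 1 + (-1) ^+ h.2 * (2 * x 0 h.1).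
Proof.
rewrite /normsq (bigD1 h.1) //= [in RHS](bigD1 h.1) //=.
rewrite mxE stepE eqxx (eq_bigr (fun i => x 0 i ^+ 2)) => [|i /negPf ih].
  by case: h.2 => /=; ring.
by rewrite mxE stepE ih addr0.
Qed.

Lemma sum_direction (V : nmodType) (F : direction d -> V) :
  \sum_h F h = \sum_i (F (i, false) + F (i, true)).
Proof.
rewrite (eq_bigr (fun h => F (h.1, h.2))); last by case.
rewrite -(pair_bigA _ (fun i b => F (i, b))) /=.
by apply: eq_bigr => i _; rewrite big_bool addrC.
Qed.

Lemma box (n : nat) :
  exists s : seq 'rV[int]_d, forall x, (forall i, `|x 0 i| <= n%:Z) -> x \in s.
Proof.
pose p (f : {ffun 'I_d -> 'I_(n.*2.+1)}) : 'rV[int]_d :=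
  \row_i ((f i : nat)%:Z - n%:Z).
exists (codom p) => x xn; apply/codomP.
exists [ffun i => inord (absz (x (0 : 'I_1) i + n%:Z))]; apply/rowP => i.
have xni : `|x 0 i| <= n%:Z := xn i.
rewrite mxE ffunE; move: (x 0 i) xni => a an; rewrite inordK; lia.
Qed.

End SquaredNorm.

(** * Transience for d = 1 and d >= 3 *)

Section TransientDimensions.
Context {R : realType}.

Lemma avoid_lower_bound_dim1 :
  exists2 e : R, 0 < e & forall m, e <= avoid m 0 (@None (direction 1)).
Proof.
pose g (x : 'rV[int]_1) : R := - `|x 0 0|%:~R.
(* The second difference of [|x|] is 2 at 0 and 0 elsewhere, hence [c = 1] is enough. *)
apply: (@avoid_lower_bound_superharmonic R 1 _ g 1 1) => // [x|N].
  rewrite /neighbor_sum sum_direction big_ord1 /g !add_stepE !eqxx /=.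
  have -> : (x == 0) = (x 0 0 == 0).
    apply/eqP/eqP => [->|x0]; first by rewrite mxE.
    by apply/rowP => i; rewrite (ord1 i) mxE.
  move: (x 0 0) => a; rewrite expr0 expr1.
  have -> : (a == 0)%:R = (a == 0)%:~R :> R by [].
  rewrite mul1r; have -> : (2 * 1)%:R = 2%:~R :> R by [].
  by rewrite -!(intrN, intrM, intrD) ler_int; lia.
(* Since [2d - 1 = 1], the last two boundary terms form a single increment, and [g] is
   1-Lipschitz. *)
have lip n y o : expect n g y o - expect n.+1 g y o <= 1.
  elim: n y o => [|n IHn] y o.
    rewrite lerBlDl -lerBlDr expectS -[leLHS](mean_const _ o) //.
    apply: mean_le => h; rewrite /= /g add_stepE lerBlDr.
    rewrite -[1]/(1%:~R : R) -!intrN -intrD ler_int (ord1 h.1) eqxx.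
    by case: h.2; rewrite /= ?expr0 ?expr1; lia.
  rewrite expectS [X in _ - X]expectS -[leRHS](mean_const _ o) //.
  rewrite lerBlDr -meanD; apply: mean_le => h.
  by rewrite -lerBlDr; apply: IHn.
have := lip N 0 None; have : expect 1 g 0 None <= 0.
  apply: le_trans (expect_le _ _ _ (g2 := fun=> 0) _) _ => [x|].
    by rewrite /g oppr_le0 ler0z.
  by rewrite expect_const.
have -> : g 0 = 0 by rewrite /g mxE normr0 oppr0.
rewrite (_ : (2 * 1).-1%:R = 1 :> R) //; lra.
Qed.

(** The bound [P] is the cubic Taylor polynomial of [(1 + t)^(-1/2)] plus [t^4], the true quartic
    coefficient being only 35/128. Squaring reduces the claim to [1 <= P^2 (1 + t)]. *)
Lemma inv_sqrt_taylor (t : R) : `|t| <= 1 / 3 ->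
  (Num.sqrt (1 + t))^-1 <=
  1 - t / 2 + 3 / 8 * t ^+ 2 - 5 / 16 * t ^+ 3 + t ^+ 4.
Proof.
rewrite ler_norml => /andP[t1 t2]; set P := (X in _ <= X).
have t2_le : t ^+ 2 <= 1 / 9 by nra.
have P0 : 0 <= P by rewrite /P; nra.
have sq1 : 0 < Num.sqrt (1 + t) by rewrite sqrtr_gt0; lra.
rewrite -[leLHS]mul1r ler_pdivrMr //.
rewrite -(ger0_norm P0) -sqrtr_sqr -sqrtrM ?sqr_ge0 // -[leLHS]sqrtr1.
rewrite ler_sqrt; last by rewrite mulr_ge0 ?sqr_ge0 //; lra.
rewrite -subr_ge0.
(* Agreement to third order makes the difference divisible by [t^4]; the cofactor is nonnegative for
   [|t| <= 1/3]. *)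
have -> : P ^+ 2 * (1 + t) - 1 = t ^+ 4 * (93 / 64 + 39 / 32 * t
    - 99 / 256 * t ^+ 2 + 57 / 256 * (t * t ^+ 2) + 3 / 8 * (t ^+ 2) ^+ 2
    + t * (t ^+ 2) ^+ 2).
  by rewrite /P; field.
apply: mulr_ge0; first by rewrite -[4%N]/(2 * 2)%N exprM sqr_ge0.
move: t2_le (sqr_ge0 t); set u := t ^+ 2 => u1 u0; nra.
Qed.

(** Adding the Taylor bounds at [a / s] and [- a / s] cancels the odd terms. *)
Lemma inv_sqrt_pair (s a : R) : 0 < s -> `|a / s| <= 1 / 3 ->
  (Num.sqrt (s + a))^-1 + (Num.sqrt (s - a))^-1 <=
  (Num.sqrt s)^-1 * (2 + 3 / 4 * (a / s) ^+ 2 + 2 * (a / s) ^+ 4).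
Proof.
move=> s0 t3; set t := a / s.
have -> : s + a = s * (1 + t) by rewrite /t; field; lra.
have -> : s - a = s * (1 + - t) by rewrite /t; field; lra.
rewrite !sqrtrM ?(ltW s0) // !invfM -mulrDr ler_pM2l ?invr_gt0 ?sqrtr_gt0 //.
apply: le_trans (lerD (inv_sqrt_taylor t3) (inv_sqrt_taylor _)) _.
  by rewrite normrN.
by rewrite -/t le_eqVlt; clearbody t; apply/orP; left; apply/eqP; field.
Qed.

Definition radial {d : nat} (y : 'rV[int]_d) : R :=
  (Num.sqrt (normsq y + 10)%:~R)^-1.

(* [3 <= d] enters as [3 / (r + 11) <= d / (r + 11)], the drift that beats the
   second-order term [3 r / (r + 11) ^ 2]; the shift by 10 absorbs the
   fourth-order terms. *)
Lemma radial_superharmonic (d : nat) (x : 'rV[int]_d) : (3 <= d)%N ->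
  neighbor_sum radial x < (2 * d)%:R * radial x.
Proof.
move=> d3; pose g := @radial d.
rewrite -/g.
pose r : R := (normsq x)%:~R; pose s := r + 11.
pose X i : R := (x 0 i)%:~R.
have r0 : 0 <= r by rewrite ler0z normsq_ge0.
have s0 : 0 < s by rewrite /s; lra.
have rX : r = \sum_i X i ^+ 2.
  by rewrite /r /normsq rmorph_sum; apply: eq_bigr => i _; rewrite rmorphXn.
have Xr i : X i ^+ 2 <= r by rewrite /X /r -rmorphXn ler_int sqr_coord_le.
have pair i : g (x + step (i, false)) + g (x + step (i, true)) <=
    (Num.sqrt s)^-1 * (2 + X i ^+ 2 * (3 * s ^- 2 + 32 * r * s ^- 4)).
  have -> : g (x + step (i, false)) = (Num.sqrt (s + 2 * X i))^-1.
    rewrite /g /radial normsq_step /= expr0 mul1r /s /r /X; congr (Num.sqrt _)^-1.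
    rewrite !intrD intrM; ring.
  have -> : g (x + step (i, true)) = (Num.sqrt (s - 2 * X i))^-1.
    rewrite /g /radial normsq_step /= expr1 mulN1r /s /r /X; congr (Num.sqrt _)^-1.
    rewrite !intrD intrN intrM; ring.
  apply: le_trans (inv_sqrt_pair s0 _) _.
    rewrite normrM (ger0_norm (x := s^-1)) ?invr_ge0 ?(ltW s0) // ler_pdivrMr //.
    (* [6 |X i| <= (X i)^2 + 9 <= s]. *)
    have := sqr_ge0 (X i - 3); have := sqr_ge0 (X i + 3); have := Xr i.
    rewrite ler_norml /s; move: (X i) => a ? ? ?; apply/andP; split; nra.
  rewrite ler_pM2l ?invr_gt0 ?sqrtr_gt0 // -addrA lerD2l.
  have -> : 3 / 4 * (2 * X i / s) ^+ 2 + 2 * (2 * X i / s) ^+ 4 =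
      X i ^+ 2 * (3 * s ^- 2 + 32 * X i ^+ 2 * s ^- 4) by field; lra.
  rewrite ler_wpM2l ?sqr_ge0 // lerD2l ler_wpM2r ?invr_ge0 ?exprn_ge0 ?(ltW s0) //.
  by have := Xr i; lra.
rewrite /neighbor_sum sum_direction.
apply: le_lt_trans (ler_sum _ (fun i _ => pair i)) _.
rewrite -mulr_sumr big_split /= -mulr_suml -rX sumr_const card_ord.
have -> : g x = (Num.sqrt (s - 1))^-1.
  by rewrite /g /radial /s /r intrD; congr (Num.sqrt _)^-1; ring.
have s1 : 0 < s - 1 by rewrite /s; lra.
have small : r * (3 * s ^- 2 + 32 * r * s ^- 4) < d%:R / s.
  apply: (@lt_le_trans _ _ (3 / s)); last first.
    by rewrite ler_pM2r ?invr_gt0 // (ler_nat R 3 d).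
  rewrite -subr_gt0.
  have -> : 3 / s - r * (3 * s ^- 2 + 32 * r * s ^- 4) =
            (3 * s ^+ 3 - 3 * r * s ^+ 2 - 32 * r ^+ 2) / s ^+ 4 by field; lra.
  rewrite divr_gt0 ?exprn_gt0 //.
  have -> : 3 * s ^+ 3 - 3 * r * s ^+ 2 - 32 * r ^+ 2 = 33 * s ^+ 2 - 32 * r ^+ 2.
    by rewrite /s; ring.
  by rewrite /s; nra.
(* [1 + 1 / (2s)] is the first-order expansion of [(1 - 1/s)^(-1/2)] and lies below it; this links
   [s], the center of the neighbor pairs, to [s - 1], the value at [x]. *)
apply: (@lt_le_trans _ _ ((2 * d)%:R * ((Num.sqrt s)^-1 * (1 + 1 / (2 * s))))).
  rewrite mulrCA ltr_pM2l ?invr_gt0 ?sqrtr_gt0 //.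
  have -> : (2 * d)%:R * (1 + 1 / (2 * s)) = 2 *+ d + d%:R / s :> R.
    by rewrite natrM -mulr_natr; field; lra.
  by rewrite ltrD2l.
rewrite ler_wpM2l // -[leRHS]mul1r ler_pdivlMr ?sqrtr_gt0 //.
rewrite -mulrA mulrC ler_pdivrMr ?sqrtr_gt0 // [leRHS]mul1r.
have p0 : 0 <= 1 + 1 / (2 * s).
  by rewrite addr_ge0 // divr_ge0 //; lra.
rewrite -(ger0_norm p0) -sqrtr_sqr -sqrtrM ?sqr_ge0 // ler_sqrt ?(ltW s0) //.
rewrite -subr_ge0.
have -> : s - (1 + 1 / (2 * s)) ^+ 2 * (s - 1) = (3 * s + 1) / (4 * s ^+ 2).
  by field; lra.
by rewrite divr_ge0 // ?mulr_ge0 ?sqr_ge0 //; lra.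
Qed.

Lemma avoid_lower_bound_dim3 (d : nat) : (3 <= d)%N ->
  exists2 e : R, 0 < e & forall m, e <= avoid m 0 (@None (direction d)).
Proof.
move=> d3; have d0 : (0 < d)%N by lia.
pose g := @radial d.
have g_super x : neighbor_sum g x < (2 * d)%:R * g x.
  exact: radial_superharmonic.
have g0 x : 0 <= g x by rewrite invr_ge0 sqrtr_ge0.
have g1 x : g x <= 1.
  have n0 := normsq_ge0 x.
  have n1 : 1 <= (normsq x + 10)%:~R :> R by rewrite (ler_int R 1); lia.
  rewrite invf_le1; first by rewrite -[leLHS]sqrtr1 ler_sqrt // (le_trans ler01).
  by rewrite sqrtr_gt0 (lt_le_trans ltr01).
apply: (@avoid_lower_bound_superharmonic R d d0 g
  ((2 * d)%:R * g 0 - neighbor_sum g 0) ((2 * d).-1%:R + 1)) => [|x|N].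
- by rewrite subr_gt0.
- case: eqP => [->|_]; first by rewrite mulr1.
  by rewrite mulr0 subr_ge0 ltW.
have q0 : 0 <= (2 * d).-1%:R :> R by [].
have E n : 0 <= expect n g 0 None <= 1.
  rewrite expect_ge0 //=; apply: le_trans (expect_le _ _ _ (g2 := fun=> 1) _) _ => //.
  by rewrite expect_const.
have /andP[_ e1] := E 1%N; have /andP[_ e2] := E N; have /andP[e3 _] := E N.+1.
have := ler_wpM2l q0 e1; have := mulr_ge0 q0 e3; have := g0 0; lra.
Qed.

End TransientDimensions.

(** * Recurrence in the plane *)

Section PlanarRecurrence.
Context {R : realType}.
Implicit Types x : 'rV[int]_2.

(* [ln (2 r - 1)] with [r = |x| ^ 2] is superharmonic on the plane wherever it
   is defined; the value 1 / 63 at the origin makes [ln weight] harmonic at the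
   four neighbors of the origin as well, since 7 * 3 * 3 / 63 = 1. *)
Definition weight (r : int) : R := if r == 0 then 63^-1 else (2 * r - 1)%:~R.

Lemma weight_gt0 (r : int) : 0 <= r -> 0 < weight r.
Proof.
by rewrite /weight; case: eqP => [_ _|r0 ?]; rewrite ?invr_gt0 // ltr0z; lia.
Qed.

(** The four factors are the weights of the neighbors of the site with coordinates [a, b]: this is
    superharmonicity of [ln weight] in product form. *)
Lemma prod_weight_le (a b : int) : let r := a ^+ 2 + b ^+ 2 in r != 0 ->
  weight (r + 1 + 2 * a) * weight (r + 1 - 2 * a) *
  (weight (r + 1 + 2 * b) * weight (r + 1 - 2 * b)) <= weight r ^+ 4.
Proof.
move=> r r0; have [r1|r1] := eqVneq r 1.
  have ab : (a = 0 /\ (b = 1 \/ b = -1)) \/ (b = 0 /\ (a = 1 \/ a = -1)).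
    by move: r1; rewrite /r; nia.
  rewrite r1 /weight.
  by case: ab => -[-> [->|->]] /=; lra.
have r2 : 2 <= r.
  by have := sqr_ge0 a; have := sqr_ge0 b; move: r0 r1; rewrite /r; lia.
(* For [r >= 2] no neighbor is the origin, so only the polynomial branch of [weight] occurs. *)
rewrite /weight (negPf r0).
have -> : (r + 1 + 2 * a == 0) = false by apply/eqP; rewrite /r; nia.
have -> : (r + 1 - 2 * a == 0) = false by apply/eqP; rewrite /r; nia.
have -> : (r + 1 + 2 * b == 0) = false by apply/eqP; rewrite /r; nia.
have -> : (r + 1 - 2 * b == 0) = false by apply/eqP; rewrite /r; nia.
rewrite -rmorphXn -!intrM ler_int -subr_ge0.
have -> : (2 * r - 1) ^+ 4 - (2 * (r + 1 + 2 * a) - 1) * (2 * (r + 1 - 2 * a) - 1) *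
   ((2 * (r + 1 + 2 * b) - 1) * (2 * (r + 1 - 2 * b) - 1)) =
   64 * (a ^+ 2 - b ^+ 2) ^+ 2 by rewrite /r; ring.
by rewrite mulr_ge0 ?sqr_ge0.
Qed.

Lemma normsq2 x : normsq x = x 0 0 ^+ 2 + x 0 1 ^+ 2.
Proof.
rewrite /normsq big_ord_recl big_ord1; congr (_ + x 0 _ ^+ 2).
exact/val_inj.
Qed.

Lemma neighbor_sum2 (g : 'rV[int]_2 -> R) x : neighbor_sum g x =
  (g (x + step (0, false)) + g (x + step (0, true))) +
  (g (x + step (1, false)) + g (x + step (1, true))).
Proof.
rewrite /neighbor_sum sum_direction big_ord_recl big_ord1.
by congr (_ + (g (x + step (_, _)) + g (x + step (_, _)))); apply/val_inj.
Qed.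

Definition log_weight x : R := ln (weight (normsq x)).

Lemma log_weight_superharmonic x : x != 0 ->
  neighbor_sum log_weight x <= 4 * log_weight x.
Proof.
move=> x0; have w0 y : 0 < weight (normsq y) by rewrite weight_gt0 ?normsq_ge0.
have wP y : weight (normsq y) \is Num.pos by rewrite posrE.
rewrite neighbor_sum2 /log_weight -!lnM ?posrE ?mulr_gt0 //.
rewrite -[4]/(4%:R) mulr_natl -lnXn // ler_ln ?posrE ?exprn_gt0 ?mulr_gt0 //.
rewrite !normsq_step /= expr0 expr1 !mul1r !mulN1r normsq2.
by apply: prod_weight_le; rewrite -normsq2 normsq_eq0.
Qed.

Lemma log_weight0 : log_weight 0 = - ln 63.
Proof. by rewrite /log_weight normsq0 /weight eqxx lnV ?posrE. Qed.

Lemma log_weight_step h : log_weight (step h) = 0.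
Proof.
rewrite /log_weight -[step h]add0r normsq_step normsq0 mxE.
by rewrite !mulr0 addr0 add0r /weight /= ln1.
Qed.

Definition cap (M : R) x : R := Num.max 0 (M - log_weight x).

(** At 0 the value is [M + ln 63] and all neighbors have value [M]. Elsewhere, the maximum of 0 and
    a function subharmonic there is again subharmonic. *)
Lemma cap_subharmonic M x : 0 <= M ->
  4 * cap M x - neighbor_sum (cap M) x <= 4 * ln 63 * (x == 0)%:R.
Proof.
move=> M0; have capM y : M - log_weight y <= cap M y by rewrite le_max lexx orbT.
have cap0 y : 0 <= cap M y by rewrite le_max lexx.
have l63 : 0 <= ln 63 :> R by rewrite ln_ge0 // ler1n.
have [->|x0] := eqVneq x 0.
  have -> : neighbor_sum (cap M) 0 = 4 * M.
    rewrite /neighbor_sum (eq_bigr (fun=> M)) => [|h _].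
      by rewrite sumr_const card_direction mulr_natl.
    by rewrite add0r /cap log_weight_step subr0; apply/max_idPr.
  rewrite /cap log_weight0 opprK; have -> : Num.max 0 (M + ln 63) = M + ln 63.
    by apply/max_idPr; lra.
  by rewrite mulr1; lra.
rewrite mulr0 {1}/cap maxEle; case: ifP => _.
  have sumM : 4 * M = \sum_(h : direction 2) M.
    by rewrite sumr_const card_direction mulr_natl.
  rewrite mulrBr subr_le0; apply: (@le_trans _ _ (4 * M - neighbor_sum log_weight x)).
    by rewrite lerD2l lerN2 log_weight_superharmonic.
  by rewrite sumM -sumrB; apply: ler_sum => h _.
by rewrite mulr0 sub0r oppr_le0 sumr_ge0.
Qed.

(** [cap M] vanishes once [weight] reaches [expR M], so its support lies in a box, and its peak is
    [M + ln 63], at 0. In this form, bounds on visits control the expectations of [cap M]. *)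
Lemma cap_support M : 0 <= M -> exists s : seq 'rV[int]_2,
  forall v, cap M v <= \sum_(x <- s) (M + ln 63) * (v == x)%:R.
Proof.
move=> M0; pose n := Num.bound (expR M).
have [s sP] := @box 2 n; exists s => v.
have l63 : 0 <= ln 63 :> R by rewrite ln_ge0 // ler1n.
have tail0 t : 0 <= \sum_(x <- t) (M + ln 63) * (v == x)%:R.
  by apply: sumr_ge0 => x _; rewrite mulr_ge0 ?addr_ge0.
have [vs|vs] := boolP (v \in s).
  elim: s vs {sP} => // y s IHs; rewrite inE big_cons.
  have [_ _|_ /= /IHs] := eqVneq v y; last by rewrite mulr0 add0r.
  rewrite mulr1; apply: ler_wpDr; first exact: tail0.
  rewrite /cap ge_max addr_ge0 //= lerD2l.
  have [->|v0] := eqVneq v 0; first by rewrite log_weight0 opprK.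
  apply: (@le_trans _ _ 0) => //; rewrite oppr_le0 ln_ge0 //.
  by rewrite /weight normsq_eq0 (negPf v0) ler1z;
    move: v0 (normsq_ge0 v); rewrite -normsq_eq0; lia.
apply: le_trans (tail0 s); rewrite ge_max lexx /= subr_le0 leNgt.
apply: contra vs => vM; apply: sP => i.
have wM : weight (normsq v) < expR M.
  by rewrite -ltr_ln ?posrE ?expR_gt0 ?expRK // weight_gt0 ?normsq_ge0.
have Mn : expR M < n%:Z%:~R by apply: archi_boundP; apply: expR_ge0.
have := lt_trans wM Mn; rewrite /weight; have := sqr_coord_le v i.
move: (v 0 i) => a; case: eqP => [->|_]; first by nia.
by rewrite ltr_int; nia.
Qed.

Lemma avoid_vanishes_dim2 (e : R) : 0 < e ->
  exists m, avoid m 0 (@None (direction 2)) < e.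
Proof.
move=> e0; apply: contrapT => /forallNP av.
have {}av m : e <= avoid m 0 (@None (direction 2)).
  by rewrite leNgt; apply/negP/av.
have l63 : 0 <= ln 63 :> R by rewrite ln_ge0 // ler1n.
have visits n x : \sum_(k < n) visit k x 0 (@None (direction 2)) <= e^-1 :> R.
  exact: sum_visit_le.
have ie0 : 0 <= e^-1 by rewrite invr_ge0 ltW.
(* The telescoped identity will give [2M - ln 63 - 3 <= 4 ln 63 / e], which this [M] violates. *)
pose M := 2 * ln 63 * e^-1 + ln 63 + 3 / 2 + 1.
have M0 : 0 <= M.
  have := mulr_ge0 l63 ie0; rewrite /M; lra.
have [s sP] := cap_support M0.
pose B := (M + ln 63) * e^-1 * (size s)%:R.
have capB n : \sum_(k < n) expect k (cap M) 0 (@None (direction 2)) <= B.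
  apply: (@le_trans _ _
    (\sum_(k < n) \sum_(x <- s) (M + ln 63) * visit k x 0 (@None (direction 2)))).
    apply: ler_sum => k _; under eq_bigr do rewrite -expectZ.
    by rewrite -expect_sum; apply: expect_le.
  have -> : B = \sum_(x <- s) (M + ln 63) * e^-1.
    by rewrite big_const_seq count_predT iter_addr_0 /B mulr_natr.
  rewrite exchange_big.
  apply: ler_sum => x _; rewrite -mulr_sumr; apply: ler_wpM2l => //.
  by rewrite addr_ge0.
(* The expectations of [cap M] have bounded partial sums, so they cannot all exceed 1 after time
   0. *)
have [N capN] : exists N, expect N.+1 (cap M) 0 (@None (direction 2)) <= 1.
  apply: contrapT => /forallNP big.
  pose n := Num.bound `|B|.
  have := capB n.+1; apply/negP; rewrite -ltNge big_ord_recl.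
  have Bn : B < n%:R by apply: le_lt_trans (ler_norm B) (archi_boundP _).
  apply: (lt_le_trans Bn); apply: ler_wpDl.
    by apply: expect_ge0 => // x; rewrite le_max lexx.
  have -> : n%:R = \sum_(k < n) (1 : R) by rewrite sumr_const card_ord.
  by apply: ler_sum => k _; rewrite ltW // ltNge; apply/negP/big.
have := @expect_telescope R 2 isT N (cap M) 0 None.
have le63 : \sum_(1 <= n < N.+1)
    expect n (fun x => (2 * 2)%:R * cap M x - neighbor_sum (cap M) x) 0 None
    <= 4 * ln 63 * e^-1.
  apply: (@le_trans _ _
    (\sum_(1 <= n < N.+1) 4 * ln 63 * visit n 0 0 (@None (direction 2)))).
    apply: ler_sum => n _; rewrite -expectZ; apply: expect_le => x.
    exact: cap_subharmonic.
  rewrite -mulr_sumr ler_wpM2l ?mulr_ge0 //.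
  apply: le_trans (visits N.+1 0).
  rewrite -(big_mkord xpredT (fun k => visit k 0 0 None)).
  by rewrite [leRHS]big_ltn // ler_wpDl // visit_ge0.
have E1 : expect 1 (cap M) 0 None = M.
  rewrite expectS -[RHS](mean_const (d := 2) _ None) //; apply: eq_mean => h /=.
  by rewrite add0r /cap log_weight_step subr0; apply/max_idPr.
have E0 : expect 0 (cap M) 0 None = M + ln 63.
  by rewrite /= /cap log_weight0 opprK; apply/max_idPr; lra.
have EN : 0 <= expect N (cap M) 0 None.
  by apply: expect_ge0 => // x; rewrite le_max lexx.
rewrite E1 E0 => eqN; rewrite eqN in le63.
have q3 : (2 * 2).-1%:R = 3 :> R by [].
rewrite q3 in le63; move: le63 capN EN; rewrite /M.
move: (expect N _ _ _) (expect N.+1 _ _ _) => EN EN1.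
move: (ln 63) e^-1 l63 ie0 => l i; lra.
Qed.

End PlanarRecurrence.

(** * Splitting an event along an almost sure partition *)

Section FiniteAdditivity.
Context {R : realType} {disp : measure_display} {T : measurableType disp}
  (P : probability T R).

Lemma probability_fineK (A : set T) : measurable A -> (fine (P A))%:E = P A.
Proof. by move=> mA; rewrite fineK // fin_num_measure. Qed.

Lemma probability_bigsetU (I : choiceType) (s : seq I) (F : I -> set T) (A : set T) :
  uniq s -> measurable A -> (forall i, measurable (F i)) ->
  (forall i j w, F i w -> F j w -> i = j) ->
  P (A `&` \big[setU/set0]_(i <- s) F i) = (\sum_(i <- s) P (A `&` F i))%E.
Proof.
move=> + mA mF dF; elim: s => [|i s IHs] /=.
  by rewrite !big_nil setI0 measure0.
move=> /andP[is_ us]; rewrite !big_cons setIUr -IHs // measureU //.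
- exact: measurableI.
- by apply: measurableI => //; apply: bigsetU_measurable.
apply/seteqP; split => // w [[_ Fi] [_]].
rewrite -bigcup_seq => -[j /= js Fj].
by move: is_; rewrite (dF _ _ _ Fi Fj) js.
Qed.

(** The hypothesis on [P A] says that the disjoint [F i] cover [A] almost surely. No more can be
    asked: the law of a walk makes successive vertices adjacent only almost surely. *)
Lemma probability_split (I : finType) (F : I -> set T) (A E : set T) :
  measurable A -> measurable E -> (forall i, measurable (F i)) ->
  (forall i j w, F i w -> F j w -> i = j) ->
  P A = (\sum_i P (A `&` F i))%E ->
  P (A `&` E) = (\sum_i P (A `&` F i `&` E))%E.
Proof.
move=> mA mE mF dF PA; pose U := \big[setU/set0]_i F i.
have mU : measurable U by apply: bigsetU_measurable.
have mAE : measurable (A `&` E) by apply: measurableI.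
have split B : measurable B ->
    P B = (P (B `\` U) + \sum_i P (B `&` F i))%E.
  move=> mB; rewrite -(probability_bigsetU (index_enum_uniq I) mB mF dF).
  exact: measureDI.
have AU0 : P (A `\` U) = 0%E.
  have := split A mA; rewrite -PA.
  rewrite -(probability_fineK mA) -(probability_fineK (measurableD mA mU)).
  by rewrite -EFinD => -[] h; congr EFin; lra.
rewrite (split _ mAE) (@subset_measure0 _ _ _ P _ (A `\` U)) //.
- by rewrite add0e; apply: eq_bigr => i _; rewrite setIAC.
- exact: measurableD.
- exact: measurableD.
- by move=> w [[]].
Qed.

End FiniteAdditivity.

(** * From the recursion [avoid] to the law of the given walk *)

Section WalkLaw.
Context {R : realType} {d : nat} (d_gt0 : (0 < d)%N)
  {disp : measure_display} {T : measurableType disp} (P : probability T R)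
  (v0 : 'rV[int]_d) (X : nat -> T -> 'rV[int]_d)
  (X_walk : non_backtracking_walk (@grid_adj d) P v0 X).
Implicit Types (o : option (direction d)) (x : nat -> 'rV[int]_d).

Definition last_step x (n : nat) o : Prop :=
  if n is m.+1 then exists2 h, o = Some h & x m.+1 = x m + step h
  else o = None.

Lemma eq_last_step x y n o : (forall i, (i <= n)%N -> x i = y i) ->
  last_step x n o -> last_step y n o.
Proof.
by case: n => //= n xy [h -> xn]; exists h; rewrite // -!xy // ltnW.
Qed.

Lemma nb_choices_allowed x n o : last_step x n o ->
  nb_choices (@grid_adj d) x n =
  [set` [fset (x n + step h)%R | h in allowed o]%fset].
Proof.
case: n => [/= ->|n /= [k -> xn]]; apply/seteqP; split => y /=.
- by move=> /grid_adjP[h ->]; apply/imfsetP; exists h.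
- by move=> /imfsetP[h _ ->]; apply/grid_adjP; exists h.
- move=> [/grid_adjP[h ->] yx]; apply/imfsetP; exists h => //=.
  rewrite -[X in is_true X]/(allowed (Some k) h) allowed_Some; apply/eqP => hk.
  by apply: yx; rewrite xn hk step_reverse addrK.
- move=> /imfsetP[h /= hk ->]; split; first by apply/grid_adjP; exists h.
  rewrite xn -addrA => /(congr1 (fun y => y - x n)).
  rewrite addrAC subrr add0r => /eqP; rewrite addrC addr_eq0 -step_reverse.
  move=> /eqP/step_inj hk'; move: hk.
  by rewrite -[X in is_true X]/(allowed (Some k) h) allowed_Some hk' eqxx.
Qed.

Lemma uniform_pmf_step x n o h : last_step x n o ->
  uniform_pmf R (nb_choices (@grid_adj d) x n) (x n + step h) =
  (allowed o h)%:R / #|allowed o|%:R.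
Proof.
move=> /nb_choices_allowed ->; rewrite /uniform_pmf set_fsetK indicE.
have inj : injective (fun h : direction d => x n + step h).
  by move=> a b /addrI/step_inj.
rewrite card_imfset //= -cardE; congr (_%:R / _).
rewrite mem_setE; congr nat_of_bool.
by apply/imfsetP/idP => [[k /= kh /inj ->]//|oh]; exists h.
Qed.

Definition avoids (n m : nat) : set T :=
  [set w | forall i, (n < i <= n + m)%N -> X i w <> v0].

Lemma measurable_cylinder x n : measurable (cylinder X x n).
Proof.
have -> : cylinder X x n = \bigcap_(i in [set i | (i <= n)%N]) (X i @^-1` [set x i]).
  by [].
by apply: bigcap_measurable => [|i _]; [exists 0%N | apply: nbw_measurable X_walk _ _].
Qed.

Lemma measurable_avoids n m : measurable (avoids n m).
Proof.
have -> : avoids n m =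
    \bigcap_i (if (n < i <= n + m)%N then X i @^-1` [set~ v0] else setT).
  apply/seteqP; split => w /= wa i; last by move=> im; have := wa i I; rewrite im.
  by move=> _; case: ifP => // /wa.
apply: bigcapT_measurable => i; case: ifP => _ //.
exact: nbw_measurable X_walk _ _.
Qed.

(** Markov property: of the history up to [n], only the displacement from [v0] and the last
    direction matter. The induction splits on the direction of step [n + 1]. *)
Lemma prob_avoids m n x o : last_step x n o ->
  P (cylinder X x n `&` avoids n m) =
  (P (cylinder X x n) * (avoid m (x n - v0) o)%:E)%E.
Proof.
elim: m n x o => [|m IHm] n x o xo.
  rewrite mule1; congr (P _); apply/seteqP; split => w; first by case.
  by move=> cw; split => // i; lia.
(* The history extended by the step [h]; its values beyond [n + 1] are not seen by the cylinders
   used. *)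
pose xh h i := if (i <= n)%N then x i else x n + step h.
pose F h := X n.+1 @^-1` [set x n + step h].
have mF h : measurable (F h) by apply: nbw_measurable X_walk _ _.
have cF h : cylinder X x n `&` F h = cylinder X (xh h) n.+1.
  apply/seteqP; split => w /=.
    move=> [cw Fw] i; rewrite /xh; case: ifP => [/cw//|].
    by move=> ni ni1; have -> : i = n.+1 by lia.
  move=> cw; split=> [i ni|]; last by have := cw n.+1 (leqnn _); rewrite /xh ltnn.
  by have := cw i (leqW ni); rewrite /xh ni.
have cyl_n h : cylinder X (xh h) n = cylinder X x n.
  by apply/seteqP; split => w cw i ni; have := cw i ni; rewrite /xh ni.
have last_h h : last_step (xh h) n.+1 (Some h).
  by exists h => //; rewrite /xh ltnn leqnn.
have last_n h : last_step (xh h) n o.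
  by apply: eq_last_step xo => i ni; rewrite /xh ni.
have Pstep h : P (cylinder X (xh h) n.+1) =
    (P (cylinder X x n) * ((allowed o h)%:R / #|allowed o|%:R)%:E)%E.
  rewrite (nbw_step X_walk) cyl_n; congr (_ * _%:E)%E.
  rewrite -(uniform_pmf_step h (last_n h)); congr uniform_pmf.
  by rewrite /xh ltnn leqnn.
set c := P (cylinder X x n).
have cE : c = (fine c)%:E by rewrite probability_fineK //; apply: measurable_cylinder.
rewrite (@probability_split _ _ _ P _ F) //.
- have term h : P (cylinder X x n `&` F h `&` avoids n m.+1) =
    (fine c * ((allowed o h)%:R / #|allowed o|%:R *
     ((x n - v0 + step h != 0)%:R * avoid m (x n - v0 + step h) (Some h))))%:E.
    rewrite cF; have xhS : xh h n.+1 = x n + step h by rewrite /xh ltnn.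
    have -> : x n - v0 + step h = xh h n.+1 - v0 by rewrite xhS addrAC.
    (* A step onto [v0] makes the event empty, matching the zero factor in [avoid]. *)
    have [xv|xv] := eqVneq (xh h n.+1 - v0) 0.
      rewrite mul0r !mulr0 (_ : _ `&` _ = set0) ?measure0 //.
      apply/seteqP; split => // w [/(_ n.+1 (leqnn _)) Xw /(_ n.+1)].
      apply; first by lia.
      by rewrite Xw; apply/eqP; rewrite -subr_eq0 xv.
    rewrite mul1r mulrA EFinM -[(fine c * _)%:E]/((fine c)%:E * _%:E)%E.
    rewrite -cE -Pstep -(IHm _ _ _ (last_h h)); congr (P _).
    apply/seteqP; split => w [cw aw]; split => // i im.
      by apply: aw; lia.
    have [->|ni] := eqVneq i n.+1; last by apply: aw; lia.
    rewrite (cw n.+1 (leqnn _)) => xv'; move: xv.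
    by rewrite xv' subrr eqxx.
  rewrite (eq_bigr _ (fun h _ => term h)) sumEFin [X in (X * _)%E]cE -EFinM.
  rewrite -mulr_sumr /= /mean mulr_suml; congr (_ * _)%:E.
  rewrite [RHS]big_mkcond; apply: eq_bigr => h _.
  by case: (allowed o h); rewrite ?mul0r // mul1r mulrC.
- exact: measurable_cylinder.
- exact: measurable_avoids.
- move=> h k w; rewrite /F /= => -> /addrI; exact: step_inj.
- under eq_bigr do rewrite cF Pstep -/c cE -EFinM.
  rewrite sumEFin -mulr_sumr -mulr_suml -natr_sum.
  have -> : (\sum_(h : direction d) allowed o h)%N = #|allowed o|.
    by rewrite -sum1_card [RHS]big_mkcond.
  by rewrite mulfV ?mulr1 // card_allowed_neq0.
Qed.

Lemma prob_no_return m :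
  P ([set w | X 0%N w = v0] `&` avoids 0 m) = (avoid m 0 (@None (direction d)))%:E.
Proof.
have -> : [set w | X 0%N w = v0] = cylinder X (fun=> v0) 0.
  apply/seteqP; split => w /=; last by apply.
  by move=> Xw i; rewrite leqn0 => /eqP ->.
rewrite (@prob_avoids m 0 _ None) // subrr.
have -> : cylinder X (fun=> v0) 0 = [set w | X 0%N w = v0].
  apply/seteqP; split => w /=; first by apply.
  by move=> Xw i; rewrite leqn0 => /eqP ->.
by rewrite (nbw_start X_walk) mul1e.
Qed.

Lemma measurable_start : measurable [set w | X 0%N w = v0].
Proof. exact: nbw_measurable X_walk 0%N [set v0]. Qed.

Lemma measurable_return : measurable (return_event X).
Proof.
(* [return_event] compares with the random [X 0], hence the union over the countably many sites. *)
have -> : return_event X = \bigcup_(k in [set k | (1 <= k)%N])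
    \bigcup_v (X k @^-1` [set v] `&` X 0%N @^-1` [set v]).
  apply/seteqP; split => w.
    by move=> [k [k1 Xk]]; exists k => //; exists (X 0%N w).
  by move=> [k k1 [v _ [/= Xk X0]]]; exists k; rewrite Xk X0.
apply: bigcup_measurable => k _.
apply: countable_bigcupT_measurable => [|v]; first exact: countableP.
by apply: measurableI; apply: nbw_measurable X_walk _ _.
Qed.

(** Outside the null event [X 0 <> v0], never returning implies avoiding [v0] up to every time [m],
    which has arbitrarily small probability. *)
Lemma recurrent_of_avoid :
  (forall e : R, 0 < e -> exists m, avoid m 0 (@None (direction d)) < e) ->
  recurrent P X.
Proof.
move=> av; have mR := measurable_return; have mRC := measurableC mR.
suff : P (~` return_event X) = 0%E.
  rewrite probability_setC // /recurrent -(probability_fineK P mR).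
  by rewrite -EFinB => -[] h; congr EFin; lra.
apply/eqP; rewrite eq_le measure_ge0 andbT; apply/lee_addgt0Pr => e e0.
rewrite add0e; have [m avm] := av e e0.
have {}avm : ((avoid m 0 (@None (direction d)))%:E <= e%:E)%E.
  by rewrite lee_fin ltW.
have mS := measurable_start.
have S0 : P (~` [set w | X 0%N w = v0]) = 0%E.
  by rewrite probability_setC // (nbw_start X_walk) subee.
rewrite (measureDI P mRC mS) (@subset_measure0 _ _ _ P _ (~` [set w | X 0%N w = v0])).
- rewrite add0e; apply: le_trans avm.
  rewrite -prob_no_return; apply: le_measure; rewrite ?inE.
  + exact: measurableI.
  + by apply: measurableI => //; apply: measurable_avoids.
  + move=> w [nr Xw]; split => // i /andP[i1 _] Xi; apply: nr.
    by exists i; split => //; rewrite Xi Xw.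
- exact: measurableD.
- exact: measurableC.
- by move=> w [].
- exact: S0.
Qed.

(** Continuity from above: the decreasing events of no return by time [m] have probability at least
    [e], hence so does their intersection, which excludes a return. *)
Lemma transient_of_avoid (e : R) : 0 < e ->
  (forall m, e <= avoid m 0 (@None (direction d))) -> transient P X.
Proof.
move=> e0 av; pose S := [set w | X 0%N w = v0].
have mS : measurable S := measurable_start.
pose F m := S `&` avoids 0 m.
have mF m : measurable (F m) by apply: measurableI => //; apply: measurable_avoids.
have mFF : measurable (\bigcap_m F m) by apply: bigcapT_measurable.
have cvF : P \o F @ \oo --> P (\bigcap_m F m).
  apply: nonincreasing_cvg_mu => //.
    exact: le_lt_trans (probability_le1 P (mF 0%N)) (ltry _).
  move=> m n mn; apply/subsetPset => w [Sw aw]; split => // i im.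
  by apply: aw; lia.
have eP : (e%:E <= P (\bigcap_m F m))%E.
  rewrite -(cvg_lim _ cvF) //; apply: lime_ge.
    by apply/cvg_ex; exists (P (\bigcap_m F m)).
  by apply: nearW => m; rewrite /= prob_no_return lee_fin.
have mR := measurable_return.
have : (P (\bigcap_m F m) <= P (~` return_event X))%E.
  apply: le_measure; rewrite ?inE //; first exact: measurableC.
  move=> w Fw [k [k1 Xk]]; have [Sw aw] := Fw k I.
  by apply: (aw k); rewrite ?Xk //; lia.
move=> /(le_trans eP); rewrite probability_setC // /transient.
rewrite -(probability_fineK P mR) -EFinB lee_fin lte_fin; lra.
Qed.

End WalkLaw.

Theorem theorem1 (R : realType) (d : nat) (d_ge1 : (1 <= d)%N)
  (disp : measure_display) (T : measurableType disp) (P : probability T R)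
  (v0 : 'rV[int]_d) (X : nat -> T -> 'rV[int]_d)
  (X_walk : non_backtracking_walk (@grid_adj d) P v0 X) :
  (d = 2 -> recurrent P X) /\ (d = 1 \/ (3 <= d)%N -> transient P X).
Proof.
split=> [d2|dP].
  apply: (recurrent_of_avoid d_ge1 X_walk) => e e0.
  by rewrite d2; apply: avoid_vanishes_dim2.
have [e e0 av] : exists2 e : R, 0 < e & forall m, e <= avoid m 0 (@None (direction d)).
  case: dP => [->|d3]; [exact: avoid_lower_bound_dim1|exact: avoid_lower_bound_dim3].
exact: (transient_of_avoid d_ge1 X_walk e0 av).
Qed.
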